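(* Let $\alpha>0$, $h>0$, $t>0$, and let $f$ be a real-valued function defined at $t$ and at all points $t-kh$, $k=1,2,\ldots$. Let $w_k$, $I_+$, $I_-$, $W_+$, $W_-$, $w_{k^*}$, $w_{k_*}$, the distributions $P$ and $Q$, and the independent random variables $Y^+$ (with distribution $P$) and $Y^-$ (with distribution $Q$) be as defined in the context. Let $Y_1^+,Y_2^+,\ldots$ be independent copies of $Y^+$ and let $Y_1^-,Y_2^-,\ldots$ be independent copies of $Y^-$. Assume that the expectations $\mathbb{E}_P f(t-Y^+h)$ and $\mathbb{E}_Q f(t-Y^-h)$ exist and are finite (each being required only when the corresponding set $I_+$, respectively $I_-$, is nonempty). Then, with probability one, $$\frac{1}{h^\alpha}\Bigl[f(t)+w_{k_*}f(t-k_*h)+w_{k^*}f(t-k^*h)+W_+\frac1N\sum_{n=1}^N f(t-Y_n^+h)+W_-\frac1N\sum_{n=1}^N f(t-Y_n^-h)\Bigr]\longrightarrow A_h^\alpha f(t)$$ as $N\to\infty$, where $$A_h^\alpha f(t)=\frac{1}{h^\alpha}\sum_{k=0}^\infty w_k\,f(t-kh).$$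
   Context: For $\alpha>0$ the Grünwald--Letnikov weights are $$w_k=(-1)^k\binom{\alpha}{k}=(-1)^k\frac{\alpha(\alpha-1)\cdots(\alpha-k+1)}{k!},\qquad k=0,1,2,\ldots,$$ so $w_0=1$ (equivalently $w_k=(-1)^k\frac{\Gamma(\alpha+1)}{k!\,\Gamma(\alpha-k+1)}$, with $1/\Gamma=0$ at nonpositive integers). Positive weights. If the set $\{k\ge1: w_k>0\}$ has at least two elements, put $I_+=\{k\ge 1:w_k>0\}$, $W_+=\sum_{k\in I_+}w_k$, let $P$ be the probability distribution on $I_+$ with $p_k=w_k/W_+$, $k\in I_+$, and set $w_{k^*}=0$ (the term with $k^*$ is absent). If this set consists of a single integer, call that integer $k^*$, and put $I_+=\varnothing$, $W_+=0$. If it is empty, put $I_+=\varnothing$, $W_+=0$, $w_{k^*}=0$. Negative weights. If the set $\{k\ge1: w_k<0\}$ has at least two elements, put $I_-=\{k\ge 1:w_k<0\}$, $W_-=\sum_{k\in I_-}w_k$, let $Q$ be the probability distribution on $I_-$ with $q_k=w_k/W_-$, $k\in I_-$, and set $w_{k_*}=0$ (the term with $k_*$ is absent). If this set consists of a single integer, call that integer $k_*$, and put $I_-=\varnothing$, $W_-=0$. If it is empty, put $I_-=\varnothing$, $W_-=0$, $w_{k_*}=0$. When $I_+$ (respectively $I_-$) is empty, the random variable $Y^+\equiv0$ (respectively $Y^-\equiv 0$) is used by convention, and the corresponding sum has coefficient $0$. The random variables $Y^+$ and $Y^-$ are always assumed independent. $\mathbb{E}_P$ and $\mathbb{E}_Q$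 denote expectation under $P$ and $Q$. *)

(* Defs.v *)
From HB Require Import structures.
From mathcomp Require Import all_boot all_order all_algebra.
From mathcomp Require Import finmap.
From mathcomp Require Import all_classical all_reals all_analysis.

Set Implicit Arguments.
Unset Strict Implicit.
Unset Printing Implicit Defensive.

Import Order.TTheory GRing.Theory Num.Theory.
Import numFieldNormedType.Exports.

Local Open Scope classical_set_scope.
Local Open Scope ring_scope.

Definition gl_weight (R : realType) (alpha : R) (k : nat) : R :=
  (-1) ^+ k * ((\prod_(i < k) (alpha - i%:R)) / k`!%:R).

Definition pos_indices (R : realType) (alpha : R) : set nat :=
  [set k | (1 <= k)%N /\ 0 < gl_weight alpha k].

Definition neg_indices (R : realType) (alpha : R) : set nat :=
  [set k | (1 <= k)%N /\ gl_weight alpha k < 0].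

Definition two_elements (S : set nat) : Prop :=
  exists i j : nat, [/\ S i, S j & i <> j].

Definition one_element (S : set nat) : Prop := exists k : nat, S = [set k].

Definition randomized (S : set nat) : set nat :=
  if `[< two_elements S >] then S else set0.

(* I_+ and I_- : the indices treated by simulation *)
Definition Iplus (R : realType) (alpha : R) : set nat :=
  randomized (pos_indices alpha).

Definition Iminus (R : realType) (alpha : R) : set nat :=
  randomized (neg_indices alpha).

(* the element of a singleton; for any other set the value is irrelevant, since
   it is only used with the coefficient lone_weight, which is then 0 *)
Definition lone_index (S : set nat) : nat := xget 0%N [set k | S = [set k]].

Definition lone_weight (R : realType) (alpha : R) (S : set nat) : R :=
  if `[< one_element S >] then gl_weight alpha (lone_index S) else 0.

Definition total_weight (R : realType) (alpha : R) (I : set nat) : R :=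
  \big[+%R/0]_(0 <= k <oo | k \in I) gl_weight alpha k.

(* Y has the law with mass w_k / W at k in I, or is identically 0 when I is
   empty. Point masses determine a law on nat. *)
Definition has_weight_law (R : realType) (d : measure_display)
    (T : measurableType d) (P : probability T R) (alpha : R) (I : set nat)
    (Y : {RV P >-> nat}) : Prop :=
  (I = set0 -> forall x : T, Y x = 0%N) /\
  (I !=set0 -> forall k : nat, distribution P Y [set k] =
     (if k \in I then gl_weight alpha k / total_weight alpha I else 0)%:E).

Definition independent2 (R : realType) (d d' : measure_display)
    (T : measurableType d) (U : measurableType d') (P : probability T R)
    (X Y : {RV P >-> U}) : Prop :=
  forall A B : set U, measurable A -> measurable B ->
    P (X @^-1` A `&` Y @^-1` B) = (P (X @^-1` A) * P (Y @^-1` B))%E.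

Definition mutually_independent (R : realType) (d d' : measure_display)
    (T : measurableType d) (U : measurableType d') (P : probability T R)
    (X : nat -> {RV P >-> U}) : Prop :=
  forall (J : {fset nat}) (A : nat -> set U), (forall i, measurable (A i)) ->
    P (\bigcap_(i in [set` J]) (X i @^-1` A i)) =
    (\prod_(i <- J) P (X i @^-1` A i))%E.

(* independent copies of Y0, possibly living on another probability space *)
Definition independent_copies (R : realType) (d0 d d' : measure_display)
    (T0 : measurableType d0) (T : measurableType d) (U : measurableType d')
    (P0 : probability T0 R) (P : probability T R)
    (Y0 : {RV P0 >-> U}) (Y : nat -> {RV P >-> U}) : Prop :=
  mutually_independent Y /\
  (forall (n : nat) (A : set U), measurable A ->
     distribution P (Y n) A = distribution P0 Y0 A).

(* Y takes values in nat and f is only evaluated at points t - k h, so f o Y is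
   measurable for arbitrary f; integrability says that E f(t - Y h) exists and
   is finite *)
Definition has_finite_expectation (R : realType) (d : measure_display)
    (T : measurableType d) (P : probability T R) (f : R -> R) (t h : R)
    (Y : {RV P >-> nat}) : Prop :=
  P.-integrable setT (fun x : T => (f (t - (Y x)%:R * h))%:E).

Definition gl_terms (R : realType) (alpha h : R) (f : R -> R) (t : R) : R^nat :=
  fun k => gl_weight alpha k * f (t - k%:R * h).

Definition gl_approx (R : realType) (alpha h : R) (f : R -> R) (t : R) : R :=
  (h `^ alpha)^-1 * limn (series (gl_terms alpha h f t)).

(* the N-sample estimator for given sample values; the n-th sample of the usual
   1-based numbering is yp n.-1, ym n.-1 *)
Definition gl_estimator (R : realType) (alpha h : R) (f : R -> R) (t : R)
    (yp ym : nat -> nat) (N : nat) : R :=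
  let Sp := pos_indices alpha in
  let Sm := neg_indices alpha in
  (h `^ alpha)^-1 *
  (f t + lone_weight alpha Sm * f (t - (lone_index Sm)%:R * h)
       + lone_weight alpha Sp * f (t - (lone_index Sp)%:R * h)
       + total_weight alpha (Iplus alpha) *
           (N%:R^-1 * \sum_(n < N) f (t - (yp n)%:R * h))
       + total_weight alpha (Iminus alpha) *
           (N%:R^-1 * \sum_(n < N) f (t - (ym n)%:R * h))).

(* Main.v *)
Require Import Defs.
From HB Require Import structures.
From mathcomp Require Import all_boot all_order all_algebra.
From mathcomp Require Import finmap.
From mathcomp Require Import all_classical all_reals all_analysis.
From mathcomp Require Import measurable_realfun.
From mathcomp Require Import ring lra.

Set Implicit Arguments.
Unset Strict Implicit.
Unset Printing Implicit Defensive.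

Import Order.TTheory GRing.Theory Num.Theory.
Import numFieldNormedType.Exports.

Local Open Scope classical_set_scope.
Local Open Scope ring_scope.

(** Fix one sign, and let [S] be the set of indices [k >= 1] whose weight has
    that sign.  If [S] has at least two elements, the sample mean multiplied by
    [W] estimates [W * E f(t - Y h)], that is, the sum over [S] of
    [w_k f(t - k h)]; if [S] has at most one element, that sum is the lone term
    (or is empty).  The two signs and the term [k = 0] add up to the
    Grünwald-Letnikov series.  No asymptotics of the weights is needed: as the
    masses [w_k / W] have total 1, [W] is nonzero, and the existence of
    [E f(t - Y h)] gives the absolute convergence of the sum over [S]
    (lemmas [total_weight_neq0], [cvg_randomized_part], [cvg_one_sign]).

    What remains is Kolmogorov's strong law of large numbers for integrable
    functions [g] of independent copies of an integer-valued variable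
    ([strong_law_of_large_numbers]).  For the indicator of a value [k], the
    variance of the number of occurrences among [N] samples is at most [N], so
    the frequencies converge along [N = m^2] because the sum of [1 / m^2] is
    finite, and monotonicity of the counts fills the gaps ([slln_events]).
    Hence the law holds for every [g] with finite support.  The rest of [g] is,
    uniformly in the sample size, negligible by the maximal inequality for
    sample means of a nonnegative function [psi],
      [lam * P (exists N, sum_(n < N) psi (Y_n) > N * lam) <= E psi(Y)],
    applied to the restriction [psi] of [|g|] to the integers [k >= K], whose
    mean tends to 0 as [K] grows ([maximal_inequality], [ae_tail_le]).  That
    inequality is proved by Garsia's argument, which uses only that
    [(Y_0, ..., Y_(n-1))] and [(Y_1, ..., Y_n)] have the same law
    ([ge0_integral_window_shift]). *)

(** * Largest prefix sums *)

(** The largest value of [sum_(k <- s') (psi k - lam)] over all prefixes [s'] of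
    [s]; the empty prefix makes it nonnegative.  The recursion on the first
    letter is the identity on which Garsia's argument rests. *)
Fixpoint excess (R : realType) (psi : nat -> R) (lam : R) (s : seq nat) : R :=
  if s is k :: s' then Num.max 0 (psi k - lam + excess psi lam s') else 0.

Lemma excess_ge0 (R : realType) (psi : nat -> R) lam s : 0 <= excess psi lam s.
Proof. by case: s => //= k s; rewrite le_max lexx. Qed.

Lemma excess_rcons (R : realType) (psi : nat -> R) lam s k :
  excess psi lam s <= excess psi lam (rcons s k).
Proof.
elim: s => [|j s IH]; first exact: excess_ge0.
by rewrite /= ge_max !le_max lexx /= lerD2l IH orbT.
Qed.

Lemma sum_take_le_excess (R : realType) (psi : nat -> R) lam s n :
  \sum_(k <- take n s) (psi k - lam) <= excess psi lam s.
Proof.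
elim: s n => [|j s IH] [|n] /=; rewrite ?big_nil ?le_max ?lexx//.
by rewrite big_cons lerD2l IH orbT.
Qed.

(** * Laws of finite windows of an integer-valued sequence *)

Lemma measurable_countable_comp d d' (T : measurableType d)
    (U : measurableType d') (V : countType) (Z : T -> V) (phi : V -> U) :
  (forall v, measurable (Z @^-1` [set v])) ->
  measurable_fun setT (fun w => phi (Z w)).
Proof.
move=> mZ _ B mB; rewrite setTI.
rewrite [X in measurable X](_ : _ =
    \bigcup_v (Z @^-1` [set v] `&` [set _ | B (phi v)])); last first.
  by apply/seteqP; split => [w Bw|w [v _ [/= -> //]]]; exists (Z w).
apply: countable_bigcupT_measurable => [|v]; first exact: countableP.
apply: measurableI => //.
have [Bv|nBv] := pselect (B (phi v)).
- by rewrite (_ : [set _ | _] = setT) //; apply/seteqP; split.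
- by rewrite (_ : [set _ | _] = set0) //; apply/seteqP; split.
Qed.

Lemma ge0_integral_nat_law d (T : measurableType d) (R : realType)
    (mu : {measure set T -> \bar R}) (Z : T -> nat) (phi : nat -> \bar R) :
  (forall k, measurable (Z @^-1` [set k])) -> (forall k, (0 <= phi k)%E) ->
  (\int[mu]_w phi (Z w) = \sum_(k <oo) phi k * mu (Z @^-1` [set k]))%E.
Proof.
move=> mZ phi0.
have TE : [set: T] = \bigcup_k Z @^-1` [set k].
  by apply/seteqP; split => w // _; exists (Z w).
rewrite TE ge0_integral_bigcup //.
- apply: eq_eseriesr => k _.
  rewrite (@eq_integral _ _ _ _ _ (cst (phi k))) ?integral_cst//.
  by move=> w; rewrite inE /= => ->.
- by rewrite -TE; exact: measurable_countable_comp.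
- by move=> i j _ _ [w [/= <- <-]].
Qed.

(** The finite sequence of values [Y_s(w), ..., Y_(s+n-1)(w)]. *)
Definition window (S : Type) (Y : nat -> S -> nat) (s n : nat) (w : S) :
  seq nat := [seq Y i w | i <- iota s n].

Lemma windowS (S : Type) (Y : nat -> S -> nat) s n w :
  window Y s n.+1 w = Y s w :: window Y s.+1 n w.
Proof. by []. Qed.

Lemma windowSr (S : Type) (Y : nat -> S -> nat) s n w :
  window Y s n.+1 w = rcons (window Y s n w) (Y (s + n)%N w).
Proof. by rewrite /window -addn1 iotaD map_cat /= cats1. Qed.

Section iid.
Context (R : realType) (d : measure_display) (T : measurableType d)
  (P : probability T R) (Y : nat -> {RV P >-> nat}).
Hypothesis Yindep : mutually_independent Y.
Hypothesis Yident :
  forall n k, P (Y n @^-1` [set k]) = P (Y 0 @^-1` [set k]).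

Let measurable_fibre n k : measurable (Y n @^-1` [set k]).
Proof. by rewrite -[X in measurable X]setTI; exact: measurable_funPT. Qed.

(** There are countably many windows, so these point masses determine the law of
    a window; they do not depend on its position [s]. *)
Lemma window_law s n u : P (window Y s n @^-1` [set u]) =
  (if size u == n then \prod_(k <- u) P (Y 0 @^-1` [set k]) else 0)%E.
Proof.
case: eqP => [<-|nu]; last first.
  rewrite (_ : _ @^-1` _ = set0) ?measure0//; apply/seteqP; split => w //= wu.
  by apply: nu; rewrite -wu size_map size_iota.
pose J := [fset i in iota s (size u)]%fset.
have JE : enum_fset J =i iota s (size u) by move=> i; rewrite !inE.
transitivity (P (\bigcap_(i in [set` J]) Y i @^-1` [set nth 0%N u (i - s)])).
  congr (P _); apply/seteqP; split => [w wu i /=|w wJ /=].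
    rewrite JE mem_iota => /andP[si iu].
    rewrite -[in RHS]wu (nth_map 0%N) ?size_iota ?ltn_subLR
      ?nth_iota ?subnKC //.
    by rewrite ltn_subLR.
  apply: (@eq_from_nth _ 0%N); first by rewrite size_map size_iota.
  move=> i; rewrite size_map size_iota => iu.
  rewrite (nth_map 0%N) ?size_iota// nth_iota//.
  rewrite (wJ (s + i)%N) /= ?addKn// JE mem_iota leq_addr /=.
  by rewrite ltn_add2l.
rewrite Yindep//.
rewrite (perm_big (iota s (size u))) /=; last first.
  by apply: uniq_perm => //; [exact: fset_uniq|exact: iota_uniq].
rewrite -[in RHS](mkseq_nth 0%N u) big_map.
rewrite -[X in iota X _]addn0 iotaDl big_map; apply: eq_bigr => i _.
by rewrite Yident addKn.
Qed.

Lemma measurable_window s n u : measurable (window Y s n @^-1` [set u]).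
Proof.
elim: n s u => [|n IH] s u.
  have [->|u0] := eqVneq u [::].
    by rewrite (_ : _ @^-1` _ = setT) //; apply/seteqP; split.
  rewrite (_ : _ @^-1` _ = set0) //; apply/seteqP; split => w //= /esym/eqP.
  by rewrite (negbTE u0).
case: u => [|k u].
  by rewrite (_ : _ @^-1` _ = set0) //; apply/seteqP; split.
rewrite (_ : _ @^-1` _ = Y s @^-1` [set k] `&` window Y s.+1 n @^-1` [set u]).
  exact: measurableI.
by apply/seteqP; split => w /= [<- <-].
Qed.

Lemma ge0_integral_window_shift (phi : seq nat -> \bar R) s n :
  (forall u, (0 <= phi u)%E) ->
  (\int[P]_w phi (window Y s n w) = \int[P]_w phi (window Y 0 n w))%E.
Proof.
move=> phi0.
(* windows are coded by natural numbers, so that the integral is a series *)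
have E s' : (\int[P]_w phi (window Y s' n w) = \sum_(k <oo)
    phi (CodeSeq.decode k) *
    (if size (CodeSeq.decode k) == n then
      \prod_(j <- CodeSeq.decode k) P (Y 0 @^-1` [set j]) else 0))%E.
  have codeE k : (fun w => CodeSeq.code (window Y s' n w)) @^-1` [set k] =
      window Y s' n @^-1` [set CodeSeq.decode k].
    apply/seteqP; split => w /= => [<-|->]; first by rewrite CodeSeq.codeK.
    exact: CodeSeq.decodeK.
  rewrite -(eq_integral _ (fun w =>
      phi (CodeSeq.decode (CodeSeq.code (window Y s' n w))))).
    rewrite (@ge0_integral_nat_law _ _ _ _
      (fun w => CodeSeq.code (window Y s' n w)) (phi \o CodeSeq.decode));
      last by move=> k; exact: phi0.
      apply: eq_eseriesr => k _; rewrite codeE; congr (_ * _)%E.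
      exact: window_law.
    by move=> k; rewrite codeE; exact: measurable_window.
  by move=> w _; rewrite CodeSeq.codeK.
by rewrite !E.
Qed.

(** * The maximal inequality *)

Lemma measurable_excess_event (psi : nat -> R) (lam : R) n :
  measurable [set w | 0 < excess psi lam (window Y 0 n w)].
Proof.
rewrite (_ : [set w | _] =
    (fun w => excess psi lam (window Y 0 n w)) @^-1` `]0, +oo[).
  rewrite -[X in measurable X]setTI.
  apply: (measurable_countable_comp (excess psi lam)) => // u.
  exact: measurable_window.
by apply/seteqP; split => w /=; rewrite in_itv /= andbT.
Qed.

(** The event is that the mean of [psi (Y n)] over some initial segment exceeds
    [lam] (see [sum_take_le_excess]). *)
Lemma maximal_inequality (psi : nat -> R) (lam : R) :
  0 <= lam -> (forall k, 0 <= psi k) ->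
  (\int[P]_w (psi (Y 0 w))%:E < +oo)%E ->
  (lam%:E * P (\bigcup_n [set w | (0 < excess psi lam (window Y 0 n w))%R]) <=
   \int[P]_w (psi (Y 0 w))%:E)%E.
Proof.
move=> lam0 psi0 psioo.
pose X s n w := excess psi lam (window Y s n w).
pose A n := [set w | 0 < X 0%N n w].
have mX s n : measurable_fun setT (X s n).
  by apply: measurable_countable_comp => u; exact: measurable_window.
have mEX s n : measurable_fun setT (fun w => (X s n w)%:E).
  exact/measurable_EFinP.
have mpsi : measurable_fun setT (fun w => (psi (Y 0 w))%:E).
  exact: (measurable_countable_comp (fun k => (psi k)%:E)).
have X0 s n w : (0 <= (X s n w)%:E)%E by rewrite lee_fin excess_ge0.
have psiE0 w : (0 <= (psi (Y 0 w))%:E)%E by rewrite lee_fin.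
have Xmono n w : X 0%N n w <= X 0%N n.+1 w.
  by rewrite /X windowSr excess_rcons.
have mA n : measurable (A n) by exact: measurable_excess_event.
(* X 0 n.+1 + lam <= psi (Y 0) + X 1 n holds on A n.+1, where the maximum is
   attained at a nonempty prefix; outside A n.+1, X 0 n.+1 vanishes *)
have key n : (\int[P]_w (X 0%N n.+1 w)%:E + lam%:E * P (A n.+1) <=
    \int[P]_w (psi (Y 0 w))%:E + \int[P]_w (X 0%N n w)%:E)%E.
  have -> : (\int[P]_w (X 0%N n w)%:E = \int[P]_w (X 1%N n w)%:E)%E.
    rewrite [RHS](@ge0_integral_window_shift
      (fun u => (excess psi lam u)%:E))//.
    by move=> u; rewrite lee_fin excess_ge0.
  have -> : (lam%:E * P (A n.+1) = \int[P]_w (lam%:E * (\1_(A n.+1) w)%:E))%E.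
    rewrite ge0_integralZl_EFin //; last exact/measurable_EFinP.
    by rewrite integral_indic// setIT.
  have mlam : measurable_fun setT (fun w => (lam%:E * (\1_(A n.+1) w)%:E)%E).
    by apply/measurable_EFinP; apply: measurable_funM.
  have lam1 w : (0 <= lam%:E * (\1_(A n.+1) w)%:E)%E by rewrite mule_ge0.
  rewrite -!ge0_integralD//=.
  apply: ge0_le_integral => //=.
  - by move=> w _; rewrite adde_ge0.
  - exact: emeasurable_funD.
  - exact: emeasurable_funD.
  move=> w _; rewrite lee_fin indicE.
  have [|/negP] := boolP (w \in A n.+1); rewrite ?inE /A /=.
  - rewrite /X windowS /= lt_max ltxx /= => pos.
    rewrite max_r; last exact: ltW.
    by rewrite mulr1; lra.
  - move=> /negP; rewrite -leNgt => Xle0; rewrite mulr0 addr0.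
    by rewrite (le_trans Xle0)// addr_ge0//; exact: excess_ge0.
have Xoo n : (\int[P]_w (X 0%N n w)%:E < +oo)%E.
  elim: n => [|n IH]; first by rewrite integral0.
  apply: le_lt_trans (lte_add_pinfty psioo IH).
  apply: le_trans (key n); apply: leeDl.
  by rewrite mule_ge0.
(* the expectation of X 0 n.+1 is finite and cancels from both sides of key *)
have bnd n : (lam%:E * P (A n) <= \int[P]_w (psi (Y 0 w))%:E)%E.
  case: n => [|n].
    rewrite (_ : A 0%N = set0) ?measure0 ?mule0 ?integral_ge0//.
    by apply/seteqP; split => // w; rewrite /A /X /= ltxx.
  have Xfin : (\int[P]_w (X 0%N n.+1 w)%:E)%E \is a fin_num.
    by rewrite ge0_fin_numE// integral_ge0.
  rewrite -(leeD2lE _ _ Xfin) [leRHS]addeC; apply: le_trans (key n) _.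
  rewrite leeD2l//; apply: ge0_le_integral => //= w _.
  by rewrite lee_fin; exact: Xmono.
have mUA : measurable (\bigcup_n A n) by exact: bigcup_measurable.
have Amono : nondecreasing_seq A.
  apply/nondecreasing_seqP => n; apply/subsetPset => w /=.
  by move=> /lt_le_trans; apply.
have cvgA := nondecreasing_cvg_mu mA mUA Amono.
have cvglA :
    (lam%:E * P (A n))%E @[n --> \oo] --> (lam%:E * P (\bigcup_n A n))%E.
  by apply: cvgeZl => //; exact: cvgA.
rewrite -(cvg_lim _ cvglA)//; apply: lime_le.
  by apply/cvg_ex; eexists; exact: cvglA.
exact: nearW.
Qed.

End iid.

(** * Frequencies of pairwise independent events *)

Lemma nneseries_lty_is_cvg_series (R : realType) (a : R^nat) :
  (forall n, 0 <= a n) -> (\sum_(n <oo) (a n)%:E < +oo)%E -> cvgn (series a).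
Proof.
move=> a0 aoo.
have afin : (\sum_(n <oo) (a n)%:E)%E \is a fin_num.
  by rewrite ge0_fin_numE// nneseries_ge0// => n _ _; rewrite lee_fin.
apply: nondecreasing_is_cvgn.
  apply/nondecreasing_seqP => n.
  by rewrite seriesEnat /= big_nat_recr //= lerDl.
exists (fine (\sum_(n <oo) (a n)%:E)%E) => _ [n _ <-].
rewrite -lee_fin fineK// seriesEnat /= -sumEFin.
by apply: nneseries_lim_ge => k _ _; rewrite lee_fin.
Qed.

Lemma cvg_sqr0 (R : realType) (u : R^nat) :
  u n ^+ 2 @[n --> \oo] --> 0 -> u @ \oo --> 0.
Proof.
move=> u2; apply/cvgrPdist_lt => e e0.
move/cvgrPdist_lt : u2 => /(_ _ (exprn_gt0 2 e0)).
apply: filterS => n; rewrite !sub0r !normrN normrX.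
by rewrite ltr_pXn2r// nnegrE ltW.
Qed.

Lemma floor_sqrt_exists (N : nat) : exists r : nat, (r ^ 2 <= N < r.+1 ^ 2)%N.
Proof.
elim: N => [|N [r /andP[rN Nr]]]; first by exists 0%N.
have [Nr'|Nr'] := ltnP N.+1 (r.+1 ^ 2).
  by exists r; rewrite Nr' andbT ltnW.
exists r.+1; rewrite Nr' /=.
by apply: leq_ltn_trans Nr _; rewrite ltn_exp2r.
Qed.

(** For a nondecreasing sequence [c], convergence of [c N / N] along the squares
    implies convergence: [m^2 <= N < (m+1)^2] bounds [c N / N] by
    [c (m^2) / (m+1)^2] and [c ((m+1)^2) / m^2]. *)
Lemma cvg_mean_of_squares (R : realType) (c : R^nat) (q : R) :
  (forall n, 0 <= c n) -> nondecreasing_seq c ->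
  (m ^ 2)%:R^-1 * c (m ^ 2)%N @[m --> \oo] --> q ->
  N%:R^-1 * c N @[N --> \oo] --> q.
Proof.
move=> c0 cmono cq.
have [r rP] := choice floor_sqrt_exists.
have roo : r @ \oo --> \oo.
  apply/cvgnyPge => A; exists (A ^ 2)%N => // N /= AN.
  rewrite -ltnS -(@ltn_exp2r _ _ 2)//.
  by have /andP[_] := rP N; exact: leq_ltn_trans.
pose u m : R := (m ^ 2)%:R^-1 * c (m ^ 2)%N.
have h1 : (1 - harmonic m : R) @[m --> \oo] --> (1 : R).
  rewrite -[X in _ --> X]subr0.
  by apply: cvgB; [exact: cvg_cst|exact: cvg_harmonic].
have lo : (1 - harmonic m) ^+ 2 * u m @[m --> \oo] --> q.
  rewrite -[X in _ --> X]mul1r; apply: cvgM => //.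
  by rewrite -[X in _ --> X]mulr1; exact: cvgM.
have up : (1 - harmonic m)^-1 ^+ 2 * u m.+1 @[m --> \oo] --> q.
  rewrite -[X in _ --> X]mul1r; apply: cvgM; last by rewrite (cvg_shiftS u).
  have h2 : (1 - harmonic m : R)^-1 @[m --> \oo] --> (1 : R).
    by rewrite -[X in _ --> X]invr1; apply: cvgV => //; exact: oner_neq0.
  by rewrite -[X in _ --> X]mulr1; exact: cvgM.
apply: (squeeze_cvgr _ (cvg_comp _ _ roo lo) (cvg_comp _ _ roo up)).
have : \forall N \near \oo, (1 <= r N)%N by exact: (cvgnyPge _).1.
apply: filterS => N rN1; have /andP[rN Nr] := rP N.
rewrite /= /u; set m := r N in rN1 rN Nr *.
have m0 : 0 < m%:R :> R by rewrite ltr0n.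
have N0 : 0 < N%:R :> R.
  by rewrite ltr0n (leq_trans _ rN)// expn_gt0 rN1.
have m1 : m%:R + 1 != 0 :> R by rewrite natr1 pnatr_eq0.
have hE : 1 - harmonic m = m%:R / m.+1%:R :> R.
  by rewrite /harmonic /=; field.
rewrite hE; apply/andP; split.
- have -> : (m%:R / m.+1%:R) ^+ 2 * ((m ^ 2)%:R^-1 * c (m ^ 2)%N) =
      (m.+1 ^ 2)%:R^-1 * c (m ^ 2)%N :> R.
    by rewrite !natrX; field; rewrite addrC m1 lt0r_neq0.
  apply: ler_pM; rewrite ?invr_ge0 //; last exact: cmono.
  by rewrite lef_pV2 ?posrE ?N0 ?ltr0n ?expn_gt0// ler_nat ltnW.
- have -> : (m%:R / m.+1%:R)^-1 ^+ 2 * ((m.+1 ^ 2)%:R^-1 * c (m.+1 ^ 2)%N) =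
      (m ^ 2)%:R^-1 * c (m.+1 ^ 2)%N :> R.
    by rewrite !natrX; field; rewrite addrC m1 lt0r_neq0.
  apply: ler_pM; rewrite ?invr_ge0 //; last by apply: cmono; exact: ltnW.
  by rewrite lef_pV2 ?posrE ?N0 ?ltr0n ?expn_gt0 ?rN1// ler_nat.
Qed.

Lemma sum_inv_sqr_le (R : realType) (M : nat) :
  \sum_(m < M) (m ^ 2)%:R^-1 <= 2 :> R.
Proof.
case: M => [|M]; first by rewrite big_ord0.
(* strengthened for the induction; the term m = 0 is (0 ^ 2)%:R^-1 = 0 *)
suff H : \sum_(m < M.+1) (m ^ 2)%:R^-1 <= 2 - 2 / M.+1%:R :> R.
  by apply: le_trans H _; rewrite gerBl divr_ge0.
elim: M => [|M IH].
  by rewrite big_ord_recl big_ord0 /= invr0 addr0 divr1 subrr.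
rewrite big_ord_recr /=; apply: le_trans (lerD IH (lexx _)) _.
rewrite -lerBrDl natrX -[M.+2]addn1 natrD.
have M1 : 1 <= M.+1%:R :> R by rewrite ler1n.
move: (M.+1%:R : R) M1 => x x1.
have x0 : 0 < x by lra.
have -> : 2 - 2 / (x + 1) - (2 - 2 / x) = 2 / (x * (x + 1)).
  by field; apply/andP; split; apply: lt0r_neq0; lra.
rewrite ler_pdivlMr ?mulr_gt0//; last by lra.
rewrite mulrC ler_pdivrMr ?exprn_gt0//.
nra.
Qed.

Section events.
Context (R : realType) (d : measure_display) (T : measurableType d)
  (P : probability T R) (A : nat -> set T) (q : R).
Hypothesis mA : forall n, measurable (A n).
Hypothesis PA : forall n, P (A n) = q%:E.
Hypothesis PAA : forall i j, i != j -> P (A i `&` A j) = (q * q)%:E.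

Let hits N w : R := \sum_(n < N) \1_(A n) w.

Let measurable_hits N : measurable_fun setT (hits N).
Proof. by apply: measurable_sum => n; exact: measurable_indic. Qed.

Let int1 B : measurable B -> (\int[P]_w (\1_B w)%:E = P B)%E.
Proof. by move=> mB; rewrite integral_indic// setIT. Qed.

Let q_ge0 : 0 <= q.
Proof. by rewrite -lee_fin -(PA 0). Qed.

Let q_le1 : q <= 1.
Proof. by rewrite -lee_fin -(PA 0); exact: probability_le1. Qed.

Lemma integral_hits N : (\int[P]_w (hits N w)%:E = (N%:R * q)%:E)%E.
Proof.
rewrite (eq_integral (fun w => \sum_(n < N) (\1_(A n) w)%:E)%E); last first.
  by move=> w _; rewrite sumEFin.
rewrite ge0_integral_sum => [|//|n|n w _]; last 2 first.
- by apply/measurable_EFinP; exact: measurable_indic.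
- by rewrite lee_fin.
rewrite (eq_bigr (fun=> q%:E)); last first.
  by move=> n _; rewrite int1// PA.
by rewrite sumEFin sumr_const card_ord mulr_natl.
Qed.

Lemma integral_hits_sqr N :
  (\int[P]_w (hits N w ^+ 2)%:E <= (N%:R ^+ 2 * q ^+ 2 + N%:R * q)%:E)%E.
Proof.
rewrite (eq_integral (fun w =>
    \sum_(i < N) \sum_(j < N) (\1_(A i `&` A j) w)%:E)%E); last first.
  move=> w _; rewrite (eq_bigr (fun i : 'I_N =>
    (\sum_(j < N) \1_(A i `&` A j) w)%:E)); last by move=> i _; rewrite sumEFin.
  rewrite sumEFin expr2 mulr_suml; congr (_%:E); apply: eq_bigr => i _.
  by rewrite mulr_sumr; apply: eq_bigr => j _; rewrite indicI.
have mAA i j : measurable_fun setT (fun w => (\1_(A i `&` A j) w)%:E : \bar R).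
  by apply/measurable_EFinP; apply: measurable_indic; exact: measurableI.
rewrite ge0_integral_sum => [|//|i|i w _]; last 2 first.
- exact: emeasurable_sum.
- by apply: sume_ge0 => j _; rewrite lee_fin.
have -> : (N%:R ^+ 2 * q ^+ 2 + N%:R * q)%:E =
    (\sum_(i < N) (\sum_(j < N) (q ^+ 2)%:E + q%:E))%E.
  under eq_bigr do rewrite sumEFin -EFinD.
  rewrite sumEFin; congr (_%:E).
  by rewrite !sumr_const !card_ord -mulr_natl -[_ *+ N]mulr_natl; ring.
apply: lee_sum => i _.
rewrite ge0_integral_sum => [|//|//|j w _]; last by rewrite lee_fin.
rewrite (bigD1 i)// [in leRHS](bigD1 i)// addeAC.
apply: leeD.
  by rewrite setIid int1// PA -EFinD lee_fin lerDr sqr_ge0.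
apply: lee_sum => j ji.
by rewrite int1 ?PAA 1?eq_sym ?expr2//; exact: measurableI.
Qed.

(** The variance of [hits N] is [N q (1 - q)]; the cruder bound suffices. *)
Lemma integral_hits_dev_sqr N :
  (\int[P]_w ((hits N w - N%:R * q) ^+ 2)%:E <= N%:R%:E)%E.
Proof.
have mD : measurable_fun setT (fun w => ((hits N w - N%:R * q) ^+ 2)%:E).
  by apply/measurable_EFinP; apply: measurable_funX; exact: measurable_funB.
have hits0 w : 0 <= hits N w by exact: sumr_ge0.
have Nq0 : 0 <= N%:R * q by rewrite mulr_ge0.
(* all terms are moved to the side on which they are nonnegative, so that only
   integrals of nonnegative functions occur *)
have E : (\int[P]_w ((hits N w - N%:R * q) ^+ 2)%:E +
    (2 * (N%:R * q) * (N%:R * q))%:E =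
    \int[P]_w (hits N w ^+ 2)%:E + ((N%:R * q) ^+ 2)%:E)%E.
  have -> : ((2 * (N%:R * q) * (N%:R * q))%:E =
      \int[P]_w (2 * (N%:R * q) * hits N w)%:E)%E.
    under eq_integral do rewrite EFinM.
    rewrite ge0_integralZl_EFin//.
    - by rewrite integral_hits -EFinM.
    - by move=> w _; rewrite lee_fin.
    - exact/measurable_EFinP.
    - by rewrite mulr_ge0.
  have -> : (((N%:R * q) ^+ 2)%:E = \int[P]_w cst ((N%:R * q) ^+ 2)%:E w)%E.
    rewrite integral_cst// -[LHS]mule1; congr (_ * _)%E.
    exact/esym/probability_setT.
  rewrite -!ge0_integralD//=.
  - by apply: eq_integral => w _; rewrite -!EFinD; congr (_%:E); ring.
  - by move=> w _; rewrite lee_fin sqr_ge0.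
  - by apply/measurable_EFinP; apply: measurable_funX.
  - by move=> w _; rewrite lee_fin sqr_ge0.
  - by move=> w _; rewrite lee_fin sqr_ge0.
  - by move=> w _; rewrite lee_fin !mulr_ge0.
  - by apply/measurable_EFinP; apply: measurable_funM.
have fin2 : (2 * (N%:R * q) * (N%:R * q))%:E \is a fin_num by [].
rewrite -(leeD2rE _ _ fin2) E.
apply: (le_trans (leeD (integral_hits_sqr N) (lexx _))).
rewrite -!EFinD lee_fin.
have : N%:R * q <= N%:R by rewrite ler_piMr.
by rewrite exprMn; lra.
Qed.

Lemma slln_events :
  {ae P, forall w, N%:R^-1 * \sum_(n < N) \1_(A n) w @[N --> \oo] --> q}.
Proof.
(* the squared deviations at m ^ 2 have a finite sum of expectations, hence are
   almost everywhere summable *)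
pose D m w : R := ((m ^ 2)%:R^-1 * (hits (m ^ 2) w - (m ^ 2)%:R * q)) ^+ 2.
have mD m : measurable_fun setT (fun w => (D m w)%:E).
  apply/measurable_EFinP; apply: measurable_funX; apply: measurable_funM => //.
  exact: measurable_funB.
have D0 m w : (0 <= (D m w)%:E)%E by rewrite lee_fin sqr_ge0.
have intD m : (\int[P]_w (D m w)%:E <= ((m ^ 2)%:R^-1)%:E)%E.
  under eq_integral do rewrite /D exprMn EFinM.
  rewrite ge0_integralZl_EFin//; last 2 first.
  - by move=> w _; rewrite lee_fin sqr_ge0.
  - apply/measurable_EFinP; apply: measurable_funX; exact: measurable_funB.
  have c0 : (0 <= ((m ^ 2)%:R^-1 ^+ 2 : R)%:E)%E by rewrite lee_fin sqr_ge0.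
  apply: (le_trans (lee_wpmul2l c0 (integral_hits_dev_sqr _))).
  rewrite -EFinM lee_fin expr2 -mulrA.
  rewrite ler_piMr ?invr_ge0//.
  by case: m {c0} => [|m]; rewrite ?mulr0 // mulVf.
have sumD : P.-integrable setT (fun w => \sum_(m <oo) (D m w)%:E)%E.
  apply/integrableP; split; first exact: ge0_emeasurable_sum.
  under eq_integral do rewrite gee0_abs ?nneseries_ge0//.
  rewrite integral_nneseries//.
  apply: (@le_lt_trans _ _ 2%:E); last by rewrite ltry.
  apply: lime_le.
    by apply: is_cvg_nneseries => n _ _; exact: integral_ge0.
  apply: nearW => M; rewrite big_mkord.
  apply: (@le_trans _ _ (\sum_(m < M) ((m ^ 2)%:R^-1)%:E)%E).
    by apply: lee_sum => i _; exact: intD.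
  by rewrite sumEFin lee_fin sum_inv_sqr_le.
have := integrable_ae measurableT sumD; apply: filterS => w /(_ I) Dfin.
have Dcvg : cvgn (series (fun m => D m w)).
  apply: nneseries_lty_is_cvg_series; first by move=> n; rewrite sqr_ge0.
  by rewrite ltey_eq Dfin.
have := cvg_sqr0 (cvg_series_cvg_0 Dcvg).
move=> dev0; apply: (@cvg_mean_of_squares _ (hits ^~ w)).
- by move=> n; exact: sumr_ge0.
- by apply/nondecreasing_seqP => n; rewrite /hits big_ord_recr lerDl.
rewrite -[q]add0r.
apply: cvg_trans (cvgD dev0 (cvg_cst q)).
apply: near_eq_cvg; exists 1%N => // m /= m1.
rewrite /GRing.add /= mulrBr mulKf ?subrK//.
by rewrite pnatr_eq0 -lt0n expn_gt0 m1.
Qed.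

End events.

(** * The strong law of large numbers *)

(** The deterministic part of the law: if each value [k] occurs in [y] with
    limit frequency [p k], and if the large values of [y n] contribute uniformly
    little to the means of [|g (y n)|], then the means of [g (y n)] converge to
    the mean of [g] under [p]. *)
Lemma cvg_mean_of_frequencies (R : realType) (g p : R^nat) (y : nat -> nat)
    (mu : R) :
  series (fun k => g k * p k) @ \oo --> mu ->
  (forall k, N%:R^-1 * \sum_(n < N) (y n == k)%:R @[N --> \oo] --> p k) ->
  (forall e, 0 < e -> exists K, forall N,
    \sum_(n < N) (if (K <= y n)%N then `|g (y n)| else 0) <= N%:R * e) ->
  N%:R^-1 * \sum_(n < N) g (y n) @[N --> \oo] --> mu.
Proof.
move=> gp freq tail; apply/cvgrPdist_lt => e e0.
have e3 : 0 < e / 3 by rewrite divr_gt0.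
have [K0 tailK0] := tail _ e3.
move/cvgrPdist_lt : gp => /(_ _ e3) [K1 _ gpK].
pose K := maxn K0 K1.
pose low (k : nat) : R := \sum_(j < K) g j * (k == j :> nat)%:R.
pose high k : R := if (K <= k)%N then g k else 0.
have split k : g k = low k + high k.
  rewrite /low /high; case: leqP => kK.
    rewrite big1 ?add0r// => j _; rewrite gtn_eqF ?mulr0//.
    exact: leq_trans (ltn_ord j) kK.
  rewrite (bigD1 (Ordinal kK))//= eqxx mulr1 big1 ?addr0// => j.
  rewrite -val_eqE /= => jk.
  by rewrite eq_sym (negbTE jk) mulr0.
have lowcvg : N%:R^-1 * \sum_(n < N) low (y n) @[N --> \oo] -->
    \sum_(j < K) g j * p j.
  rewrite [X in X @ _ --> _](_ : _ = fun N => \sum_(j < K)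
      g j * (N%:R^-1 * \sum_(n < N) (y n == j)%:R)); last first.
    apply/funext => N; rewrite exchange_big mulr_sumr; apply: eq_bigr => j _.
    by rewrite -mulr_sumr mulrCA.
  apply: cvg_big => [|j _]; first exact: add_continuous.
  by apply: cvgM; [exact: cvg_cst|exact: freq].
(* K0 <= K, so the values above K are among those above K0 *)
have highle N : `|N%:R^-1 * \sum_(n < N) high (y n)| <= e / 3.
  case: N => [|N]; first by rewrite big_ord0 mulr0 normr0 ltW.
  rewrite normrM (@ger0_norm _ N.+1%:R^-1) ?invr_ge0// ler_pdivrMl ?ltr0n//.
  apply: le_trans (ler_norm_sum _ _ _) _; apply: le_trans (tailK0 N.+1).
  apply: ler_sum => n _; rewrite /high geq_max.
  by case: (K0 <= y n)%N; case: (K1 <= y n)%N; rewrite /= ?normr0.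
move/cvgrPdist_lt : lowcvg => /(_ _ e3); apply: filterS => N lowN.
under eq_bigr do rewrite split.
rewrite big_split mulrDr /=.
have muK : `|mu - \sum_(j < K) g j * p j| < e / 3.
  by have := gpK K (leq_maxr _ _); rewrite seriesEord.
move: (highle N) lowN muK; rewrite !ltr_norml ler_norml.
by move=> /andP[? ?] /andP[? ?] /andP[? ?]; apply/andP; split; lra.
Qed.

Section slln.
Context (R : realType) (d : measure_display) (T : measurableType d)
  (P : probability T R) (Y : nat -> {RV P >-> nat}).
Hypothesis Yindep : mutually_independent Y.
Hypothesis Yident :
  forall n k, P (Y n @^-1` [set k]) = P (Y 0 @^-1` [set k]).
Variables (g : R^nat) (p : R^nat).
Hypothesis Yp : forall k, P (Y 0 @^-1` [set k]) = (p k)%:E.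
Hypothesis gint : (\int[P]_w `|g (Y 0 w)|%:E < +oo)%E.

Let measurable_fibre n k : measurable (Y n @^-1` [set k]).
Proof. by rewrite -[X in measurable X]setTI; exact: measurable_funPT. Qed.

Let p_ge0 k : 0 <= p k.
Proof. by rewrite -lee_fin -Yp. Qed.

Let integral_Y0 (phi : R^nat) : (forall k, 0 <= phi k) ->
  (\int[P]_w (phi (Y 0 w))%:E = \sum_(k <oo) (phi k * p k)%:E)%E.
Proof.
move=> phi0.
rewrite (@ge0_integral_nat_law _ _ _ P (Y 0) (fun k => (phi k)%:E))//.
by apply: eq_eseriesr => k _; rewrite EFinM; congr (_ * _)%E; exact: Yp.
Qed.

Let abs_sum_lty : (\sum_(k <oo) (`|g k| * p k)%:E < +oo)%E.
Proof.
by rewrite -(@integral_Y0 (fun k => `|g k|)).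
Qed.

Lemma is_cvg_series_mean : cvgn (series (fun k => g k * p k)).
Proof.
apply: normed_cvg.
rewrite (_ : [normed series _] = series (fun k => `|g k| * p k)).
  by apply: nneseries_lty_is_cvg_series => // k; rewrite mulr_ge0.
rewrite /normed_series_of; apply/funext => n; rewrite /series /=.
by apply: eq_bigr => k _; rewrite normrM (ger0_norm (p_ge0 k)).
Qed.

Lemma ae_frequency k :
  {ae P, forall w, N%:R^-1 * \sum_(n < N) (Y n w == k)%:R @[N --> \oo] --> p k}.
Proof.
have ind n w : \1_(Y n @^-1` [set k]) w = (Y n w == k)%:R :> R.
  rewrite indicE; congr (_%:R); congr nat_of_bool.
  by apply/idP/eqP; rewrite inE.
have PY n : P (Y n @^-1` [set k]) = (p k)%:E by rewrite Yident Yp.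
have PYY i j : i != j ->
    P (Y i @^-1` [set k] `&` Y j @^-1` [set k]) = (p k * p k)%:E.
  move=> ij.
  have := Yindep [fset i; j]%fset (A := fun=> [set k]) (fun=> I).
  rewrite big_fsetU1 ?inE//= big_seq_fset1 !PY -EFinM => <-; congr (P _).
  apply/seteqP; split => [w [wi wj] l /=|w wij /=].
    by rewrite !inE => /orP[] /eqP ->.
  by split; apply: wij; rewrite /= !inE eqxx ?orbT.
have := slln_events (fun n => measurable_fibre n k) PY PYY.
apply: filterS => w; under eq_fun do under eq_bigr do rewrite ind.
by [].
Qed.

(** Almost surely the part of [g] above some level [K] contributes at most [e]
    to every sample mean. *)
Lemma ae_tail_le (e : R) : 0 < e ->
  {ae P, forall w, exists K, forall N,
    \sum_(n < N) (if (K <= Y n w)%N then `|g (Y n w)| else 0) <= N%:R * e}.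
Proof.
move=> e0.
pose psi K k : R := if (K <= k)%N then `|g k| else 0.
have psi0 K k : 0 <= psi K k by rewrite /psi; case: ifP.
have psiE K : (\int[P]_w (psi K (Y 0 w))%:E =
    \sum_(K <= k <oo) (`|g k| * p k)%:E)%E.
  rewrite integral_Y0//.
  rewrite [RHS]eseries_cond [RHS]eseries_mkcond; apply: eq_eseriesr => k _ /=.
  by rewrite /psi; case: ifP; rewrite ?mul0r.
(* B K: the mean of psi K exceeds e at some time; by the maximal inequality the
   probability of B K tends to 0 *)
pose B K := \bigcup_n [set w | 0 < excess (psi K) e (window Y 0 n w)].
have mB K : measurable (B K).
  by apply: bigcup_measurable => n _; exact: measurable_excess_event.
have mcap : measurable (\bigcap_K B K) by exact: bigcapT_measurable.
have capB K :
    (e%:E * P (\bigcap_K B K) <= \sum_(K <= k <oo) (`|g k| * p k)%:E)%E.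
  rewrite -psiE.
  apply: le_trans (maximal_inequality Yindep Yident (ltW e0) (psi0 K) _).
  - apply: lee_wpmul2l; first by rewrite lee_fin ltW.
    apply: le_measure; rewrite ?inE; [exact: mcap|exact: (mB K)|].
    exact: bigcap_inf.
  - rewrite psiE; apply: le_lt_trans abs_sum_lty.
    rewrite eseries_cond eseries_mkcond; apply: lee_nneseries => k _.
    + by case: ifP; rewrite lee_fin ?mulr_ge0.
    + by case: ifP; rewrite lee_fin ?mulr_ge0.
have gp0 k : (0 <= (`|g k| * p k)%:E)%E by rewrite lee_fin mulr_ge0.
have cap0 : P (\bigcap_K B K) = 0%E.
  have : (e%:E * P (\bigcap_K B K) <= 0)%E.
    apply: (cvge_to_ge (nneseries_tail_cvg abs_sum_lty (fun k _ => gp0 k))).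
    exact: nearW.
  rewrite pmule_rle0 ?lte_fin// => Ple0.
  by apply/eqP; rewrite eq_le Ple0 measure_ge0.
exists (\bigcap_K B K); split => // w /= nw K _.
apply: contrapT => nB; apply: nw; exists K => N.
have : excess (psi K) e (window Y 0 N w) <= 0.
  by rewrite leNgt; apply/negP => pos; apply: nB; exists N.
have := sum_take_le_excess (psi K) e (window Y 0 N w) N.
rewrite take_oversize ?size_map ?size_iota// => /le_trans/[apply].
rewrite big_map -[X in iota 0 X]subn0 big_mkord sumrB sumr_const card_ord.
by rewrite subr_le0 mulr_natl.
Qed.

Lemma strong_law_of_large_numbers :
  {ae P, forall w, N%:R^-1 * \sum_(n < N) g (Y n w) @[N --> \oo] -->
    limn (series (fun k => g k * p k))}.
Proof.
have H1 := ae_foralln ae_frequency.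
have H2 := ae_foralln (fun j => ae_tail_le (harmonic_gt0 j)).
apply: filterS2 H1 H2 => w freq tail.
apply: (@cvg_mean_of_frequencies _ g p (fun n => Y n w) _ _ freq).
  exact: is_cvg_series_mean.
move=> e e0.
have [j je] : exists j, harmonic j < e :> R.
  have /cvgrPdist_lt/(_ _ e0)[j _ /(_ j (leqnn j))] := @cvg_harmonic R.
  by rewrite sub0r normrN ger0_norm ?harmonic_ge0//; exists j.
have [K HK] := tail j; exists K => N; apply: le_trans (HK N) _.
by rewrite ler_wpM2l// ltW.
Qed.

End slln.

(** * The weights of one sign *)

Lemma cvg_series_single (R : realType) (k0 : nat) (c : R) :
  series (fun k => if k == k0 then c else 0) @ \oo --> c.
Proof.
apply: cvg_near_cst; exists k0.+1 => // n /= kn.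
by rewrite /series /= -big_mkcond big_nat1_eq kn.
Qed.

Lemma randomizedE (S : set nat) : two_elements S -> randomized S = S.
Proof. by move=> S2; rewrite /randomized asboolT. Qed.

Lemma randomized_set0 (S : set nat) : ~ two_elements S -> randomized S = set0.
Proof. by move=> S2; rewrite /randomized asboolF. Qed.

Lemma total_weight_set0 (R : realType) (alpha : R) :
  total_weight alpha set0 = 0.
Proof.
rewrite /total_weight (_ : (fun n => _) = cst 0) ?lim_cst//.
by apply/funext => n; rewrite big1// => k; rewrite inE.
Qed.

Lemma lone_index_set1 (k : nat) : lone_index [set k] = k.
Proof.
have : [set j | [set k] = [set j]] (lone_index [set k]).
  by apply: xgetPex; exists k.
by move=> /seteqP[/(_ k erefl)].
Qed.

Section one_sign.
Context (R : realType) (alpha h t : R) (f : R -> R)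
  (d0 d : measure_display) (T0 : measurableType d0) (P0 : probability T0 R)
  (Y0 : {RV P0 >-> nat}) (T : measurableType d) (Pr : probability T R)
  (Y : nat -> {RV Pr >-> nat}) (S : set nat).
Hypothesis law : has_weight_law alpha (randomized S) Y0.
Hypothesis copies : independent_copies Y0 Y.
Hypothesis mean :
  randomized S !=set0 -> has_finite_expectation f t h Y0.

Let F (k : nat) : R := f (t - k%:R * h).
Let W := total_weight alpha (randomized S).
(** The terms of the series whose index lies in [S]. *)
Let restr k := if k \in S then gl_weight alpha k * F k else 0.

(** If [W] were 0, then all masses [w_k / W] would be 0 by the convention
    [x / 0 = 0], and [Y0] would have total mass 0. *)
Lemma total_weight_neq0 : randomized S !=set0 -> W != 0.
Proof.
move=> S0; apply/eqP => W0.
have mY0 k : measurable (Y0 @^-1` [set k]).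
  by rewrite -[X in measurable X]setTI; exact: measurable_funPT.
have := @ge0_integral_nat_law _ _ _ P0 Y0 (cst 1%E) mY0 (fun=> lee01).
rewrite integral_cst// mul1e.
rewrite eseries0; last first.
  move=> k _ _; rewrite /= mul1e.
  have := law.2 S0 k; rewrite -/W W0 invr0 mulr0 if_same.
  exact.
by move=> /eqP; rewrite [X in X == _](probability_setT P0 : _ = _) onee_eq0.
Qed.

(** The expectation of [F] under the law of [Y0] is the sum of [restr] divided
    by [W]: only [W <> 0] matters, not that [W] is the sum of the weights. *)
Lemma cvg_randomized_part : two_elements S ->
  cvgn (series restr) /\
  {ae Pr, forall w, W * (N%:R^-1 * \sum_(n < N) F (Y n w)) @[N --> \oo] -->
    limn (series restr)}.
Proof.
move=> S2; have RS := randomizedE S2.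
have S0 : randomized S !=set0.
  by rewrite RS; case: S2 => i [_ [Si _ _]]; exists i.
have W0 := total_weight_neq0 S0.
pose p k : R := if k \in S then gl_weight alpha k / W else 0.
have p0E k : P0 (Y0 @^-1` [set k]) = (p k)%:E.
  by have := law.2 S0 k; rewrite -/W RS.
have pE n k : Pr (Y n @^-1` [set k]) = (p k)%:E.
  by rewrite -p0E; exact: (copies.2 n [set k] I).
have mY0 k : measurable (Y0 @^-1` [set k]).
  by rewrite -[X in measurable X]setTI; exact: measurable_funPT.
have mY n k : measurable (Y n @^-1` [set k]).
  by rewrite -[X in measurable X]setTI; exact: measurable_funPT.
have Fint : (\int[Pr]_w `|F (Y 0 w)|%:E < +oo)%E.
  rewrite (@ge0_integral_nat_law _ _ _ Pr (Y 0) (fun k => `|F k|%:E))//.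
  have /integrableP[_] := mean S0.
  rewrite (@ge0_integral_nat_law _ _ _ P0 Y0 (fun k => `|(F k)%:E|%E))//.
  move/(le_lt_trans _); apply; rewrite le_eqVlt; apply/orP; left; apply/eqP.
  apply: eq_eseriesr => k _; congr (_ * _)%E.
  by transitivity (p k)%:E; [exact: pE|exact/esym/p0E].
have restrE : restr = fun k => W * (F k * p k).
  apply/funext => k; rewrite /restr /p; case: ifP => _.
    by field.
  by rewrite !mulr0.
have ident n k : Pr (Y n @^-1` [set k]) = Pr (Y 0 @^-1` [set k]).
  by rewrite !pE.
have cF := is_cvg_series_mean (pE 0%N) Fint.
have slln := strong_law_of_large_numbers copies.1 ident (pE 0%N) Fint.
have seriesE : series restr = fun n => W * series (fun k => F k * p k) n.
  by apply/funext => n; rewrite restrE /series /= mulr_sumr.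
have cW : series restr @ \oo --> W * limn (series (fun k => F k * p k)).
  by rewrite seriesE; apply: cvgM; [exact: cvg_cst|exact: cF].
split; first by apply/cvg_ex; eexists; exact: cW.
apply: filterS slln => w Fw; rewrite (cvg_lim _ cW)//.
by apply: cvgM; [exact: cvg_cst|exact: Fw].
Qed.

(** The lone term and the randomized term together estimate the part of the
    series over [S]; at least one of the two vanishes. *)
Lemma cvg_one_sign :
  cvgn (series restr) /\
  {ae Pr, forall w, lone_weight alpha S * F (lone_index S) +
      W * (N%:R^-1 * \sum_(n < N) F (Y n w)) @[N --> \oo] -->
    limn (series restr)}.
Proof.
have [S2|S2] := pselect (two_elements S).
  have [cR aeR] := cvg_randomized_part S2; split => //.
  rewrite /lone_weight asboolF; last first.
    move=> [k Sk]; case: S2 => i [j []]; rewrite Sk /= => -> ->.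
    by [].
  apply: filterS aeR => w Fw; under eq_fun do rewrite mul0r add0r.
  exact: Fw.
have W0 : W = 0 by rewrite /W randomized_set0// total_weight_set0.
have cR : series restr @ \oo --> lone_weight alpha S * F (lone_index S).
  rewrite /lone_weight; case: asboolP => [[k Sk]|S1].
    rewrite /restr Sk lone_index_set1.
    rewrite (_ : (fun j => _) =
      fun j => if j == k then gl_weight alpha k * F k else 0).
      exact: cvg_series_single.
    apply/funext => j; case: eqVneq => [->|jk].
      by rewrite mem_set.
    by rewrite memNset//; apply/eqP.
  have SE k : ~ S k.
    move=> Sk; apply: S1; exists k; apply/seteqP; split => [j Sj /=|j /= ->//].
    by apply: contrapT => jk; apply: S2; exists j, k.
  rewrite mul0r /restr (_ : (fun j => _) = fun=> 0).
    rewrite (_ : series _ = cst 0); first exact: cvg_cst.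
    by apply/funext => n; rewrite /series /= big1.
  by apply/funext => j; rewrite memNset.
split; first by apply/cvg_ex; eexists; exact: cR.
apply: aeW => w; rewrite (cvg_lim _ cR)//.
under eq_fun do rewrite W0 mul0r addr0.
exact: cvg_cst.
Qed.

End one_sign.

(** * Convergence of the estimator *)

Theorem mainTheorem2 (R : realType) (alpha h t : R) (f : R -> R)
  (d0 d : measure_display)
  (T0 : measurableType d0) (P0 : probability T0 R)
  (Yplus Yminus : {RV P0 >-> nat})
  (T : measurableType d) (Pr : probability T R)
  (Yp Ym : nat -> {RV Pr >-> nat})
  (alpha_gt0 : 0 < alpha) (h_gt0 : 0 < h) (t_gt0 : 0 < t)
  (law_plus : has_weight_law alpha (Iplus alpha) Yplus)
  (law_minus : has_weight_law alpha (Iminus alpha) Yminus)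
  (indep_plus_minus : independent2 Yplus Yminus)
  (copies_plus : independent_copies Yplus Yp)
  (copies_minus : independent_copies Yminus Ym)
  (mean_plus : Iplus alpha !=set0 -> has_finite_expectation f t h Yplus)
  (mean_minus : Iminus alpha !=set0 -> has_finite_expectation f t h Yminus) :
  cvgn (series (gl_terms alpha h f t)) /\
  {ae Pr, forall omega : T,
    (fun N : nat => gl_estimator alpha h f t
                      (fun n => Yp n omega) (fun n => Ym n omega) N)
      @ \oo --> gl_approx alpha h f t}.
Proof.
have [cp aep] := cvg_one_sign law_plus copies_plus mean_plus.
have [cm aem] := cvg_one_sign law_minus copies_minus mean_minus.
set up := series _ in cp aep; set um := series _ in cm aem.
have cvg_terms :
    series (gl_terms alpha h f t) @ \oo --> f t + limn up + limn um.
  rewrite (_ : series _ =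
      series (fun k => if k == 0%N then f t else 0) \+ up \+ um).
    by apply: cvgD => //; apply: cvgD => //; exact: cvg_series_single.
  apply/funext => n; rewrite /up /um /series /= -!big_split /=.
  apply: eq_bigr => k _; rewrite /gl_terms.
  have [->|k0] := eqVneq k 0%N.
    rewrite !memNset /=; [|by case|by case].
    rewrite !addr0 /gl_weight big_ord0 fact0 expr0 divr1 mulr1.
    by rewrite mul0r subr0 mul1r.
  rewrite add0r; have k1 : (1 <= k)%N by rewrite lt0n.
  have [wk|wk|wk] := ltgtP (gl_weight alpha k) 0.
  - rewrite memNset ?add0r; first by rewrite mem_set.
    by rewrite /pos_indices /= => -[_]; rewrite ltNge ltW.
  - rewrite mem_set// memNset ?addr0// /neg_indices /= => -[_].
    by rewrite ltNge ltW.
  - by rewrite wk mul0r !if_same addr0.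
split; first by apply/cvg_ex; eexists; exact: cvg_terms.
apply: filterS2 aep aem => w cvgp cvgm.
rewrite /gl_approx (cvg_lim _ cvg_terms)//.
rewrite [X in X @ _ --> _](_ : _ = fun N => (h `^ alpha)^-1 * (f t +
    (lone_weight alpha (pos_indices alpha) *
       f (t - (lone_index (pos_indices alpha))%:R * h) +
     total_weight alpha (Iplus alpha) *
       (N%:R^-1 * \sum_(n < N) f (t - (Yp n w)%:R * h))) +
    (lone_weight alpha (neg_indices alpha) *
       f (t - (lone_index (neg_indices alpha))%:R * h) +
     total_weight alpha (Iminus alpha) *
       (N%:R^-1 * \sum_(n < N) f (t - (Ym n w)%:R * h))))).
  apply: cvgM; first exact: cvg_cst.
  by apply: cvgD => //; apply: cvgD => //; exact: cvg_cst.
apply/funext => N; rewrite /gl_estimator; congr (_ * _).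
by ring.
Qed.
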